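(* A complete bipartite graph is labeling pseudo-Gorenstein* if and only if it is isomorphic to $K_{n,m}$ for some integers $n\geq 1$ and $m$ with $n\leq m\leq 2n-1$.
   Context: Here $K_{n,m}$ denotes the complete bipartite graph with parts of sizes $n\ge 1$ and $m\ge 1$. Let $G$ be a finite graph with no loops, no multiple edges and no isolated vertices on the vertex set $\{x_1,\ldots,x_N\}$, $N\geq 2$. Let $S=K[x_1,\ldots,x_N]$ be the polynomial ring over a field $K$, and let the edge ideal $I(G)\subset S$ be the ideal generated by the monomials $x_ix_j$ with $\{x_i,x_j\}$ an edge of $G$. For $\mathfrak{c}=(c_1,\ldots,c_N)\in(\mathbb{Z}_{>0})^N$ and an integer $q\geq 1$, let $(I(G)^q)_{\mathfrak{c}}$ be the ideal of $S$ generated by those monomials $x_1^{a_1}\cdots x_N^{a_N}\in I(G)^q$ with $a_i\leq c_i$ for all $i$. Let $\delta_{\mathfrak{c}}(I(G))$ be the largest integer $q$ with $(I(G)^q)_{\mathfrak{c}}\neq(0)$, and let $\mathcal{B}(G,\mathfrak{c})$ be the minimal set of monomial generators of $(I(G)^{\delta_{\mathfrak{c}}(I(G))})_{\mathfrak{c}}$. Let $\mathcal{D}(G,\mathfrak{c})$ be the set of all $(a_1,\ldots,a_N)\in\mathbb{Z}_{\geq 0}^N$ such that $x_1^{a_1}\cdots x_N^{a_N}$ divides some $u\in\mathcal{B}(G,\mathfrak{c})$, and let $\operatorname{conv}(\mathcal{D}(G,\mathfrak{c}))\subset\mathbb{R}^N$ be its convex hull. A lattice polytope $\mathcal{P}\subset\mathbb{R}^N$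 of dimension $N$ (all vertices in $\mathbb{Z}^N$) is normal if for each $k\geq 2$ every $\mathbf{a}\in k\mathcal{P}\cap\mathbb{Z}^N$ is a sum of $k$ elements of $\mathcal{P}\cap\mathbb{Z}^N$, where $k\mathcal{P}=\{k\mathbf{b}:\mathbf{b}\in\mathcal{P}\}$. (It is known that $\operatorname{conv}(\mathcal{D}(G,\mathfrak{c}))$ is a normal lattice polytope of dimension $N$.) A normal polytope $\mathcal{P}\subset\mathbb{R}^N$ of dimension $N$ is pseudo-Gorenstein* if $|(\mathcal{P}\setminus\partial\mathcal{P})\cap\mathbb{Z}^N|=1$. A finite graph $G$ on $N$ vertices is labeling pseudo-Gorenstein* if there is $\mathfrak{c}\in(\mathbb{Z}_{>0})^N$ for which $\operatorname{conv}(\mathcal{D}(G,\mathfrak{c}))\subset\mathbb{R}^N$ is pseudo-Gorenstein*. *)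

(* Defs.v *)
From HB Require Import structures.
From mathcomp Require Import all_boot all_order all_algebra.
From mathcomp Require Import all_classical all_reals topology normedtype convex.
(* The notations of mpoly clash with those of MathComp-Analysis:
   [mpoly N K] is {mpoly K[N]}, [multinom N] is 'X_{1..N}, [mpolyX K a] is the
   monomial 'X_[a], [mnm1 i] is U_(i) and [lem a u] is (a <= u)%MM. *)
From mathcomp Require Import -(notations) mpoly.

Set Implicit Arguments.
Unset Strict Implicit.
Unset Printing Implicit Defensive.

Import Order.TTheory GRing.Theory Num.Theory.
Import numFieldNormedType.Exports.

Local Open Scope classical_set_scope.
Local Open Scope ring_scope.

Section Graphs.

Definition simple_graph (V : finType) (e : rel V) : Prop :=
  ssrbool.symmetric e /\ irreflexive e.

Definition no_isolated_vertex (V : finType) (e : rel V) : Prop :=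
  forall x, exists y, e x y.

Definition graph_iso (V W : finType) (e : rel V) (e' : rel W) : Prop :=
  exists2 f : V -> W, bijective f & forall x y, e' (f x) (f y) = e x y.

Definition complete_bipartite_rel (n m : nat) : rel ('I_n + 'I_m)%type :=
  fun x y => match x, y with
             | inl _, inr _ | inr _, inl _ => true
             | _, _ => false
             end.

Definition complete_bipartite (V : finType) (e : rel V) : Prop :=
  exists n m, [/\ (1 <= n)%N, (1 <= m)%N &
                  graph_iso e (@complete_bipartite_rel n m)].

End Graphs.

Section Ideals.
Variable A : comNzRingType.

Definition ideal_gen (X : set A) : set A :=
  [set p | exists2 s : seq (A * A), (forall z, z \in s -> X z.2) &
                                    p = \sum_(z <- s) z.1 * z.2].

Definition ideal_pow (I : set A) (q : nat) : set A :=
  ideal_gen [set p | exists2 f : 'I_q -> A, (forall i, I (f i)) &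
                                            p = \prod_i f i].

End Ideals.

Section EdgeIdeal.
Variables (K : fieldType) (N : nat).
Implicit Types (e : rel 'I_N) (c : 'I_N -> nat).

Definition monomials (B : set (multinom N)) : set (mpoly N K) :=
  [set mpolyX K a | a in B].

Definition edge_ideal e : set (mpoly N K) :=
  ideal_gen [set p | exists i j, e i j /\
                       p = mpolyX K (mnm1 i) * mpolyX K (mnm1 j)].

(* (I(G)^q)_c *)
Definition bounded_pow e c (q : nat) : set (mpoly N K) :=
  ideal_gen (monomials [set a | ideal_pow (edge_ideal e) q (mpolyX K a) /\
                                forall i, (a i <= c i)%N]).

Definition is_delta e c (q : nat) : Prop :=
  [/\ (1 <= q)%N, bounded_pow e c q <> [set 0] &
      forall q', (1 <= q')%N -> bounded_pow e c q' <> [set 0] -> (q' <= q)%N].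

(* Such a largest integer exists when G has an edge and every c i is positive;
   the default value 0 is then irrelevant. *)
Definition delta e c : nat := xget 0%N (is_delta e c).

Definition is_minimal_gens (J : set (mpoly N K)) (B : set (multinom N)) : Prop :=
  ideal_gen (monomials B) = J /\
  forall B', B' `<=` B -> ideal_gen (monomials B') = J -> B' = B.

(* A monomial ideal has exactly one minimal set of monomial generators; it is
   represented here by the set of exponent vectors. *)
Definition minimal_gens (J : set (mpoly N K)) : set (multinom N) :=
  xget set0 (is_minimal_gens J).

Definition Bset e c : set (multinom N) :=
  minimal_gens (bounded_pow e c (delta e c)).

Definition Dset e c : set (multinom N) :=
  [set a | exists2 u, Bset e c u & lem a u].

End EdgeIdeal.

Section Polytopes.
Variables (R : realType) (N : nat).
Implicit Types (A P : set 'rV[R]_N) (a : 'rV[R]_N).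

Definition conv A : set 'rV[R]_N := smallest (@convex_set R 'rV[R]_N) A.

Definition lattice_point a : Prop := forall i, a ord0 i \is a Num.int.

Definition polytope P : Prop := exists2 A, finite_set A & P = conv A.

Definition vertex P a : Prop :=
  P a /\ forall x y (t : R), P x -> P y -> 0 < t < 1 ->
           a = t *: x + (1 - t) *: y -> x = a /\ y = a.

Definition lattice_polytope P : Prop :=
  polytope P /\ forall a, vertex P a -> lattice_point a.

(* dim P = N: P contains N + 1 affinely independent points. *)
Definition full_dimensional P : Prop :=
  exists a (M : 'M[R]_N),
    [/\ P a, forall i, P (a + row i M) & \rank M = N].

Definition dilate (k : nat) P : set 'rV[R]_N := [set k%:R *: b | b in P].

Definition normal_polytope P : Prop :=
  [/\ lattice_polytope P, full_dimensional P &
      forall (k : nat) a, (2 <= k)%N -> dilate k P a -> lattice_point a ->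
        exists2 b : 'I_k -> 'rV[R]_N,
          (forall i, P (b i) /\ lattice_point (b i)) & a = \sum_i b i].

Definition pseudo_Gorenstein_star P : Prop :=
  normal_polytope P /\ ([set a | interior P a /\ lattice_point a] #= `I_1)%card.

Definition exponent_vector (a : multinom N) : 'rV[R]_N := \row_i (a i)%:R.

End Polytopes.

Definition labeling_pseudo_Gorenstein_star
    (K : fieldType) (R : realType) (N : nat) (e : rel 'I_N) : Prop :=
  exists2 c : 'I_N -> nat, (forall i, (0 < c i)%N) &
    pseudo_Gorenstein_star
      (conv [set exponent_vector R a | a in Dset K e c]).

(* Main.v *)
From Pilot Require Import Defs.
From HB Require Import structures.
From mathcomp Require Import all_boot all_order all_algebra.
From mathcomp Require Import all_classical all_reals.
From mathcomp Require Import interval_inference topology normedtype convex.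
From mathcomp Require Import -(notations) mpoly.
From mathcomp Require Import ring lra zify.
(* [conv] is to denote the convex hull, not the operator of convex spaces. *)
Import Pilot.Defs.

(** Let the two sides of the complete bipartite graph be [p] and its complement
    and write [weight r a] for the sum of [a] over the side [r]. Each edge has
    one end on either side, so a monomial lies in the [q]-th power of the edge
    ideal exactly when both its side weights are at least [q] ([mem_ideal_pow]).
    Hence [delta] is [capacity], the smaller of the two weights of [c]; the
    minimal generators are the vectors bounded by [c] with both weights equal
    to the capacity; and their divisors are all the vectors bounded by [c] with
    both weights at most the capacity ([DsetE]).

    Let [P] be the convex hull of these vectors. It is normal for every [c]: a
    lattice point of its [k]-th dilate is split by dealing the units of each
    side cyclically to [k] players ([deal2]). Its interior lattice points are
    the integer vectors that satisfy all the defining inequalities strictly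
    ([interior_latticeP]). Both facts hold because [P] lies in the polyhedron
    cut out by the inequalities and contains all its lattice points.

    It remains to decide when there is exactly one such vector. If there is
    one, the all-ones vector qualifies, and uniqueness forces [c] to be 2 on
    the lighter side and the side sizes [n], [m] to satisfy
    [n <= m <= 2 n - 1] ([unique_interior_sizes]). Conversely, under these
    inequalities [c = 2] works: the capacity is [2 n], and the all-ones vector
    is the only one strictly between 0 and [c]. *)

Set Implicit Arguments.
Unset Strict Implicit.
Unset Printing Implicit Defensive.

Import Order.TTheory GRing.Theory Num.Theory.
Import numFieldNormedType.Exports.

(** * Weights of the sides of a bipartition *)

Section Sides.
Variable I : finType.
Implicit Types (p : pred I) (a b c : I -> nat) (q : nat).

Definition weight p a := \sum_(i | p i) a i.

Lemma weight_leP p a b : (forall i, p i -> a i <= b i) -> weight p a <= weight p b.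
Proof. by move=> h; apply: leq_sum. Qed.

Lemma weight_const p m : weight p (fun=> m) = #|p| * m.
Proof. exact: sum_nat_const. Qed.

Lemma weight_lt p a b : (exists i, p i) -> (forall i, p i -> a i < b i) ->
  weight p a < weight p b.
Proof.
move=> [i pi] ab; rewrite /weight (bigD1 i) //= [ltnRHS](bigD1 i) //= -addSn.
by rewrite leq_add ?ab // leq_sum // => j /andP[/ab/ltnW].
Qed.

(** Discrete intermediate values: one unit at a time leads from [a] up to [c]
    without leaving the box between them. *)
Lemma weight_between p a c q :
  (forall i, a i <= c i) -> weight p a <= q <= weight p c ->
  exists2 b : I -> nat, (forall i, a i <= b i <= c i) & weight p b = q.
Proof.
elim: q => [|q IH] ac /andP[aq qc].
  by exists a => [i|]; [rewrite leqnn ac | apply/eqP; rewrite -leqn0].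
move: aq; rewrite leq_eqVlt ltnS => /predU1P[aq|aq].
  by exists a => // i; rewrite leqnn ac.
have [|b abc bq] := IH ac; first by rewrite aq ltnW.
have /existsP[i /andP[pi bi]] : [exists i, p i && (b i < c i)].
  apply: contraTT qc => /existsPn h; rewrite -leqNgt -bq; apply: weight_leP => i pi.
  by have := h i; rewrite pi -leqNgt.
exists (fun j => b j + (j == i)) => [j|].
  have /andP[ab bc] := abc j; rewrite (leq_trans ab) ?leq_addr//=.
  by case: eqVneq => [->|_]; rewrite ?addn0 ?addn1.
rewrite /weight big_split /= -/(weight p b) bq (bigD1 i) //= eqxx big1 ?addn0 ?addn1 //.
by move=> j /andP[_ /negPf->].
Qed.

Lemma weight_between2 p a c q :
  (forall i, a i <= c i) ->
  weight p a <= q <= weight p c -> weight (predC p) a <= q <= weight (predC p) c ->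
  exists b : I -> nat, [/\ forall i, a i <= b i <= c i,
     weight p b = q & weight (predC p) b = q].
Proof.
move=> ac h1 h2.
have [b1 bac1 bq1] := weight_between ac h1.
have [b2 bac2 bq2] := weight_between ac h2.
exists (fun i => if p i then b1 i else b2 i); split=> [i||]; first by case: ifP.
  by rewrite -[RHS]bq1; apply: eq_bigr => i ->.
by rewrite -[RHS]bq2; apply: eq_bigr => i /negPf->.
Qed.
End Sides.

(** * Monomial ideals *)

Section Ideals.
Local Open Scope classical_set_scope.
Local Open Scope ring_scope.

Lemma ideal_gen_least (A : comNzRingType) (X J : set A) :
  J 0 -> (forall x y, J x -> J y -> J (x + y)) ->
  (forall x y, J y -> J (x * y)) -> X `<=` J -> ideal_gen X `<=` J.
Proof.
move=> J0 JD JM XJ p [s Xs ->]; elim: s Xs => [|z s IH] Xs; first by rewrite big_nil.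
rewrite big_cons; apply: JD; first by apply/JM/XJ/Xs/mem_head.
by apply: IH => y ys; apply: Xs; rewrite in_cons ys orbT.
Qed.

Lemma ideal_gen0 (A : comNzRingType) (X : set A) : ideal_gen X 0.
Proof. by exists [::] => //; rewrite big_nil. Qed.

Lemma ideal_genMl (A : comNzRingType) (X : set A) x y : X y -> ideal_gen X (x * y).
Proof.
by move=> Xy; exists [:: (x, y)] => [z|]; rewrite ?big_seq1 // inE => /eqP->.
Qed.

Lemma ideal_gen_sub (A : comNzRingType) (X Y : set A) :
  X `<=` ideal_gen Y -> ideal_gen X `<=` ideal_gen Y.
Proof.
apply: ideal_gen_least; first exact: ideal_gen0.
  move=> _ _ [s Ys ->] [t Yt ->]; exists (s ++ t); last by rewrite big_cat.
  by move=> z; rewrite mem_cat => /orP[/Ys|/Yt].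
move=> x _ [s Ys ->]; exists [seq (x * z.1, z.2) | z <- s].
  by move=> _ /mapP[z /Ys Yz ->].
by rewrite big_map mulr_sumr; apply: eq_bigr => z _; rewrite mulrA.
Qed.
End Ideals.

Section Monomials.
Variables (K : fieldType) (N : nat).
Local Open Scope classical_set_scope.
Local Open Scope ring_scope.
Implicit Types (B : set (multinom N)) (p : mpoly N K).

(** A polynomial lies in a monomial ideal exactly when all its monomials do;
    [supported] lets ideal membership be read off exponents. *)
Definition supported B p := {in msupp p, forall m, B m}.

Lemma supportedX B a : supported B (mpolyX K a) <-> B a.
Proof.
rewrite /supported msuppX; split => [|Ba m]; first by apply; rewrite mem_head.
by rewrite inE => /eqP->.
Qed.

Lemma supported0 B : supported B 0.
Proof. by move=> m; rewrite msupp0. Qed.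

Lemma supportedD B p q : supported B p -> supported B q -> supported B (p + q).
Proof. by move=> Bp Bq m /msuppD_le; rewrite mem_cat => /orP[/Bp|/Bq]. Qed.

Lemma supportedM B1 B2 B p q :
  (forall a b, B1 a -> B2 b -> B (mnm_add a b)) ->
  supported B1 p -> supported B2 q -> supported B (p * q).
Proof. by move=> h Bp Bq m /msuppM_le /allpairsP[[a b] /= [/Bp ? /Bq ? ->]]; apply: h. Qed.

Definition multiples B : set (multinom N) := [set b | exists2 a, B a & lem a b].

Lemma ideal_gen_monomials_supported B :
  ideal_gen (@monomials K N B) `<=` [set p | supported (multiples B) p].
Proof.
apply: ideal_gen_least => [|p q|p q|_ [a Ba <-]].
- exact: supported0.
- exact: supportedD.
- apply: (@supportedM setT) => // a b _ [d Bd db]; exists d => //.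
  exact: lepm_trans db (lem_addl _ _).
by apply/supportedX; exists a => //; exact: lepm_refl.
Qed.

Lemma mem_ideal_gen_monomials B a :
  ideal_gen (@monomials K N B) (mpolyX K a) <-> multiples B a.
Proof.
split=> [/ideal_gen_monomials_supported/supportedX//|[b Bb ba]].
by rewrite -(submK ba) mpolyXD; apply: ideal_genMl; exists b.
Qed.

Lemma ideal_gen_monomialsE B B' : B `<=` multiples B' -> B' `<=` multiples B ->
  ideal_gen (@monomials K N B) = ideal_gen (@monomials K N B').
Proof.
by move=> h h'; apply/seteqP; split; apply: ideal_gen_sub => _ [a Ba <-];
  apply/mem_ideal_gen_monomials; [apply: h|apply: h'].
Qed.

Lemma lem_anti (a b : multinom N) : lem a b -> lem b a -> a = b.
Proof.
move=> /mnm_lepP ab /mnm_lepP ba; apply/mnmP => i.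
by apply/eqP; rewrite eqn_leq ab ba.
Qed.

(** Any other set of exponents generating the same ideal contains [B]: an
    element of [B] lies above one of its members, which lies above an element
    of [B], so all three coincide. This one inclusion yields both minimality
    and uniqueness. *)
Lemma minimal_gens_antichain B :
  (forall a b, B a -> B b -> lem a b -> a = b) ->
  minimal_gens (ideal_gen (@monomials K N B)) = B.
Proof.
move=> Banti.
have sub B' : ideal_gen (@monomials K N B') = ideal_gen (@monomials K N B) -> B `<=` B'.
  move=> eqB a Ba.
  have /mem_ideal_gen_monomials[b B'b ba] : ideal_gen (@monomials K N B') (mpolyX K a).
    by rewrite eqB; apply/mem_ideal_gen_monomials; exists a => //; exact: lepm_refl.
  have /mem_ideal_gen_monomials[d Bd db] : ideal_gen (@monomials K N B) (mpolyX K b).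
    by rewrite -eqB; apply/mem_ideal_gen_monomials; exists b => //; exact: lepm_refl.
  have da : d = a by apply: Banti => //; exact: lepm_trans db ba.
  by rewrite da in db; rewrite (lem_anti db ba).
have minB : is_minimal_gens (ideal_gen (@monomials K N B)) B.
  by split=> // B' B'B /sub BB'; apply/seteqP.
have [genB' minB'] := xgetPex set0 (ex_intro _ _ minB).
by symmetry; apply: minB' => //; exact: sub.
Qed.
End Monomials.

(** * Powers of the edge ideal of a complete bipartite graph *)

Section Multinomials.
Variable N : nat.
Implicit Types (r : pred 'I_N) (a b : multinom N) (f : 'I_N -> nat).

Definition mnm_of f : multinom N := Multinom [tuple f i | i < N].

Lemma mnm_ofE f : mnm_of f =1 f.
Proof. by move=> i; rewrite multinomE tnth_mktuple. Qed.

Lemma weight_mnm_of r f : weight r (mnm_of f) = weight r f.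
Proof. by apply: eq_bigr => i _; exact: mnm_ofE. Qed.

Lemma weightD r a b : weight r (mnm_add a b) = weight r a + weight r b.
Proof. by rewrite /weight -big_split /=; apply: eq_bigr => i _; rewrite mnmDE. Qed.

Lemma weight1 r (i : 'I_N) : weight r (mnm1 i) = r i :> nat.
Proof.
rewrite /weight; have [ri|ri] := boolP (r i).
  rewrite (bigD1 i) //= mnm1E eqxx big1 ?addn0 // => j /andP[_ ji].
  by rewrite mnm1E eq_sym (negPf ji).
rewrite big1 // => j rj; rewrite mnm1E; case: eqVneq => // ij.
by rewrite ij rj in ri.
Qed.
End Multinomials.

Section Bipartite.
Variables (K : fieldType) (N : nat) (e : rel 'I_N) (p : pred 'I_N).
Hypothesis e_bip : forall i j, e i j = (p i != p j).
Local Open Scope classical_set_scope.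
Local Open Scope ring_scope.
Implicit Types (a b : multinom N) (c : 'I_N -> nat) (q : nat).

Definition sides_ge q : set (multinom N) :=
  [set a | (q <= weight p a)%N /\ (q <= weight (predC p) a)%N].

Lemma sides_geD q q' a b :
  sides_ge q a -> sides_ge q' b -> sides_ge (q + q')%N (mnm_add a b).
Proof. by move=> [a1 a2] [b1 b2]; split; rewrite weightD leq_add. Qed.

Lemma edge_ideal_supported : edge_ideal e `<=` [set f : mpoly N K | supported (sides_ge 1) f].
Proof.
apply: ideal_gen_least => [|f g|f g|f [i [j [eij ->]]]].
- exact: supported0.
- exact: supportedD.
- apply: (@supportedM _ _ setT) => // a b _ [b1 b2].
  by split; rewrite weightD (leq_trans _ (leq_addl _ _)).
rewrite -mpolyXD; apply/supportedX; split; rewrite weightD !weight1 /=;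
  by move: eij; rewrite e_bip; case: (p i); case: (p j).
Qed.

Lemma ideal_pow_supported q :
  ideal_pow (edge_ideal e) q `<=` [set f : mpoly N K | supported (sides_ge q) f].
Proof.
apply: ideal_gen_least => [|f g|f g|f [h hI ->]].
- exact: supported0.
- exact: supportedD.
- apply: (@supportedM _ _ setT) => // a b _ [b1 b2].
  by split; rewrite weightD (leq_trans _ (leq_addl _ _)).
elim: q h hI => [|q IH] h hI; first by rewrite big_ord0 => m _; split.
rewrite big_ord_recr /=; apply: (@supportedM _ _ (sides_ge q) (sides_ge 1)).
- move=> a b aq b1; rewrite -addn1; exact: sides_geD.
- by apply: IH => i; apply: hI.
- exact: edge_ideal_supported.
Qed.

(** Every vertex of one side is joined to every vertex of the other, so edges
    can be peeled off greedily as long as both sides carry weight. *)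
Lemma sides_ge_pow q a : sides_ge q a ->
  exists h : nat -> mpoly N K, exists2 r,
    (forall i, edge_ideal e (h i)) & mpolyX K a = r * \prod_(i < q) h i.
Proof.
elim: q a => [|q IH] a [ap aq].
  exists (fun=> 0), (mpolyX K a) => [i|]; first exact: ideal_gen0.
  by rewrite big_ord0 mulr1.
have pos r : (q < weight r a)%N -> exists2 i, r i & (0 < a i)%N.
  move=> qr; apply/exists_inP; apply: contraTT qr => /exists_inPn h.
  by rewrite -leqNgt [weight _ _]big1 // => i /h; rewrite lt0n negbK => /eqP.
have [i pi ai] := pos _ ap; have [j pj aj] := pos _ aq.
have {}pj : p j = false by apply: negbTE.
have ij : i != j by apply: contraFneq pj => <-.
set u := mnm_add (mnm1 i) (mnm1 j).
have ua : lem u a.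
  apply/mnm_lepP => k; rewrite mnmDE !mnm1E.
  case: eqVneq => [<-|_]; first by rewrite eq_sym (negPf ij) addn0.
  by case: eqVneq => [<-|_].
have [|h [r hI a'E]] := IH (mnm_sub a u).
  move: ap aq; rewrite -{1 2}(submK ua).
  by rewrite !weightD !weight1 /= pi pj /= !addn0 !add0n !addn1 !ltnS; split.
exists (fun k => if k == q then mpolyX K u else h k), r.
  move=> k; case: ifP => // _; rewrite -[mpolyX K u]mul1r; apply: ideal_genMl.
  by exists i, j; rewrite mpolyXD e_bip pi pj.
rewrite -(submK ua) mpolyXD a'E -mulrA big_ord_recr /= eqxx; congr (_ * (_ * _)).
by apply: eq_bigr => k _; rewrite ltn_eqF.
Qed.

Lemma mem_ideal_pow q a :
  ideal_pow (edge_ideal e) q (mpolyX K a) <-> sides_ge q a.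
Proof.
split=> [/ideal_pow_supported/supportedX//|/sides_ge_pow[h [r hI ->]]].
by apply: ideal_genMl; exists h.
Qed.

(** The largest power of the edge ideal that survives the bound [c]. Its
    symmetric form avoids having to know which side is the lighter one. *)
Definition capacity c := minn (weight p c) (weight (predC p) c).

Lemma bounded_pow_neq0 c q : @bounded_pow K N e c q <> [set 0] <-> (q <= capacity c)%N.
Proof.
rewrite /bounded_pow; split=> [|qc].
  apply: contra_notT; rewrite /capacity leq_min => qc.
  suff -> : [set a | ideal_pow (edge_ideal e) q (mpolyX K a) /\
                  forall i, (a i <= c i)%N] = set0.
    apply/seteqP; split=> [_ [[|z s] Xs ->]|_ ->]; first by rewrite big_nil.
      by have [? []] := Xs z (mem_head _ _).
    exact: ideal_gen0.
  apply/seteqP; split=> // a [/mem_ideal_pow[ap aq] ac]; apply: contraNP qc => _.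
  by rewrite (leq_trans ap) ?(leq_trans aq) //; apply: weight_leP.
move=> J0; pose a := mnm_of c.
have := oner_neq0 K; rewrite -[1]/(true%:R) -(eqxx a) -mcoeffX => /eqP; apply.
suff : [set 0] (mpolyX K a) by move=> ->; rewrite mcoeff0.
rewrite -J0 -[mpolyX K a]mul1r; apply: ideal_genMl; exists a => //; split.
  by apply/mem_ideal_pow; split; rewrite weight_mnm_of (leq_trans qc) ?geq_minl ?geq_minr.
by move=> i; rewrite mnm_ofE.
Qed.

Lemma deltaE c : (0 < capacity c)%N -> delta K e c = capacity c.
Proof.
move=> c0; have is_d : is_delta K e c (capacity c).
  by split=> // [|q' _]; rewrite bounded_pow_neq0.
have [_ /bounded_pow_neq0 h1 h2] := xgetPex 0%N (ex_intro _ _ is_d).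
by apply/eqP; rewrite eqn_leq h1 h2 // bounded_pow_neq0.
Qed.

(** A bounded monomial of the top power may exceed the capacity on the heavier
    side; lowering that side to the capacity gives a divisor in the set on the
    right. That set is an antichain because its members have equal weights on
    both sides. *)
Lemma BsetE c : (0 < capacity c)%N ->
  Bset K e c = [set u | [/\ forall i, (u i <= c i)%N,
     weight p u = capacity c & weight (predC p) u = capacity c]].
Proof.
move=> c0; rewrite /Bset deltaE // /bounded_pow.
set B := [set u | _]; rewrite -[RHS](@minimal_gens_antichain K) -/B; last first.
  move=> a b [ac ap aq] [bc bp bq] /mnm_lepP ab.
  have eq_on r : weight r a = weight r b -> forall i, r i -> a i = b i.
    move=> wab i ri; apply/eqP; rewrite eqn_leq ab /= leqNgt; apply/negP => abi.
    suff : (weight r a < weight r b)%N by rewrite wab ltnn.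
    rewrite /weight (bigD1 i) //= [X in (_ < X)%N](bigD1 i) //= -addSn leq_add //.
    exact: leq_sum.
  apply/mnmP => i; have [pi|pi] := boolP (p i).
    by apply: (eq_on p) => //; rewrite ap bp.
  by apply: (eq_on (predC p)) => //; rewrite aq bq.
congr minimal_gens; apply: ideal_gen_monomialsE => [a [/mem_ideal_pow[ap aq] ac]|u [uc up uq]].
  have [//|||b [ba bp bq]] := @weight_between2 _ p (fun=> 0%N) a (capacity c).
  - by rewrite ap [weight _ _]big1.
  - by rewrite aq [weight _ _]big1.
  exists (mnm_of b); last by apply/mnm_lepP => i; rewrite mnm_ofE; case/andP: (ba i).
  split=> [i||]; rewrite ?weight_mnm_of // mnm_ofE (leq_trans _ (ac i)) //.
  by case/andP: (ba i).
exists u; last exact: lepm_refl.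
by split=> //; apply/mem_ideal_pow; split; rewrite ?up ?uq.
Qed.

Definition feasible c (a : 'I_N -> nat) := [/\ forall i, (a i <= c i)%N,
  (weight p a <= capacity c)%N & (weight (predC p) a <= capacity c)%N].

(** A vector below the box and below the capacity on each side can be raised
    to a generator, one side at a time. *)
Lemma DsetE c : (0 < capacity c)%N -> Dset K e c = [set a | feasible c a].
Proof.
move=> c0; rewrite /Dset BsetE //; apply/seteqP.
split=> [a [u [uc up uq] /mnm_lepP au]|a [ac ap aq]].
  split; first by move=> i; exact: leq_trans (au i) (uc i).
    by rewrite -up; apply: weight_leP.
  by rewrite -uq; apply: weight_leP.
have [||b [abc bp bq]] := weight_between2 (p := p) (q := capacity c) ac.
- by rewrite ap geq_minl.
- by rewrite aq geq_minr.
exists (mnm_of b); last by apply/mnm_lepP => i; rewrite mnm_ofE; case/andP: (abc i).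
by split=> [i||]; rewrite ?weight_mnm_of // mnm_ofE; case/andP: (abc i).
Qed.
End Bipartite.

(** * Dealing integer vectors *)

Section Dealing.
Variable I : finType.
Implicit Types (p : pred I) (a b c : I -> nat) (k l o q : nat).

(** If the units are dealt cyclically to [k] players, [dealt k l o n] is what
    player [l] receives out of the [n] consecutive units starting at number
    [o]. Since hands are counted by residues, consecutive batches add up. *)
Definition dealt k l o n := \sum_(o <= t < o + n) (t %% k == l).

Lemma dealtD k l o m n : dealt k l o (m + n) = dealt k l o m + dealt k l (o + m) n.
Proof. by rewrite /dealt addnA (@big_cat_nat _ _ _ (o + m)) ?leq_addr. Qed.

(** [k] consecutive units have distinct residues. *)
Lemma dealt_window k l o : dealt k l o k <= 1.
Proof.
have dealtSr o' n : dealt k l o' n.+1 = dealt k l o' n + ((o' + n) %% k == l).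
  by rewrite /dealt addnS big_nat_recr ?leq_addr.
elim: o => [|o IH].
  rewrite /dealt add0n big_mkord; have [lk|kl] := ltnP l k.
    rewrite (bigD1 (Ordinal lk)) //= modn_small // eqxx big1 // => i il.
    by rewrite modn_small // -(inj_eq val_inj) /= in il *; rewrite (negPf il).
  by rewrite big1 // => i _; rewrite modn_small // ltn_eqF // (leq_trans _ kl).
suff : dealt k l o k = dealt k l o.+1 k by move=> <-.
by have := dealtD k l o 1 k; rewrite add1n dealtSr modnDr addn1 [dealt k l o 1]/dealt addn1 big_nat1 addnC => /addnI.
Qed.

Lemma dealt_le k l o n q : n <= k * q -> dealt k l o n <= q.
Proof.
elim: q o n => [|q IH] o n; first by rewrite muln0 leqn0 => /eqP->; rewrite /dealt addn0 big_geq.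
rewrite mulnS => nkq; have [nk|kn] := leqP n k.
  apply: leq_trans (leq_trans (dealt_window k l o) _) => //.
  by have := dealtD k l o n (k - n); rewrite subnKC // => ->; exact: leq_addr.
rewrite -(subnKC (ltnW kn)) dealtD -add1n leq_add ?dealt_window // IH //.
by rewrite leq_subLR.
Qed.

Lemma sum_dealt k o n : 0 < k -> \sum_(l < k) dealt k l o n = n.
Proof.
move=> k0; rewrite exchange_big /= -[RHS]muln1 -[in RHS](addKn o n) -sum_nat_const_nat.
apply: eq_bigr => t _; rewrite (bigD1 (Ordinal (ltn_pmod t k0))) //= eqxx big1 // => l lt.
by rewrite eq_sym; move: lt; rewrite -(inj_eq val_inj) /= => /negPf->.
Qed.

(** The coordinates are laid end to end and dealt as a single stream. Each
    coordinate, and also the whole, is then a batch of consecutive units, so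
    that [dealt_le] bounds the coordinates and the total at once. *)
Lemma deal_seq k o a (r : seq I) : uniq r -> exists b : nat -> I -> nat,
  (forall i, exists o', forall l, b l i = dealt k l o' (a i)) /\
  forall l, \sum_(i <- r) b l i = dealt k l o (\sum_(i <- r) a i).
Proof.
elim: r o => [|x r IH] o /=.
  exists (fun l i => dealt k l 0 (a i)); split=> [i|l]; first by exists 0.
  by rewrite !big_nil /dealt addn0 big_geq.
case/andP=> xr /(IH (o + a x))[b [bo bs]].
exists (fun l i => if i == x then dealt k l o (a x) else b l i); split.
  by move=> i; case: eqVneq => [->|_]; [exists o|exact: bo].
move=> l; rewrite !big_cons eqxx dealtD -bs; congr (_ + _).
by apply: eq_big_seq => i ir; case: eqVneq => // ix; rewrite -ix ir in xr.
Qed.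

Lemma deal_weight k p a q : 0 < k -> weight p a <= k * q -> exists b : nat -> I -> nat,
  [/\ forall l i m, a i <= k * m -> b l i <= m, forall i, \sum_(l < k) b l i = a i &
   forall l, weight p (b l) <= q].
Proof.
move=> k0 aq; have [b [bo bs]] := deal_seq k 0 a (filter_uniq p (index_enum_uniq I)).
exists b; split.
- by move=> l i m am; have [o ->] := bo i; exact: dealt_le.
- by move=> i; have [o bE] := bo i; rewrite -[RHS](sum_dealt o (a i) k0); apply: eq_bigr.
by move=> l; rewrite /weight -big_filter bs big_filter; exact: dealt_le.
Qed.

(** Integer decomposition: both sides are dealt out independently, each player
    receiving a vector that respects the undilated constraints. *)
Lemma deal2 k p a c q : 0 < k -> (forall i, a i <= k * c i) ->
  weight p a <= k * q -> weight (predC p) a <= k * q -> exists b : nat -> I -> nat,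
  (forall i, \sum_(l < k) b l i = a i) /\
  forall l, [/\ forall i, b l i <= c i, weight p (b l) <= q & weight (predC p) (b l) <= q].
Proof.
move=> k0 ac /(deal_weight k0)[b1 [c1 s1 w1]] /(deal_weight k0)[b2 [c2 s2 w2]].
exists (fun l i => if p i then b1 l i else b2 l i); split=> [i|l].
  by case: (p i); rewrite ?s1 ?s2.
split=> [i||]; first by case: ifP => _; [apply: c1|apply: c2].
  by apply: leq_trans (w1 l); apply: weight_leP => i ->.
by apply: leq_trans (w2 l); apply: weight_leP => i /negPf->.
Qed.
End Dealing.

(** * Convex hulls and interiors *)

Section Convex.
Variables (R : realType) (N : nat).
Local Open Scope classical_set_scope.
Local Open Scope ring_scope.
Implicit Types (A C : set 'rV[R]_N) (a x y : 'rV[R]_N).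

Lemma convex_setP C : @convex_set R 'rV[R]_N C <->
  forall x y (t : R), C x -> C y -> 0 <= t <= 1 -> C (t *: x + (1 - t) *: y).
Proof.
split=> [hC x y t Cx Cy /andP[t0 t1]|hC x y t].
  by have := hC x y (Itv01 t0 t1); rewrite !inE => h; exact: h.
by rewrite !inE => Cx Cy; apply: hC => //; rewrite ge0 le1.
Qed.

Lemma conv_convex A : @convex_set R 'rV[R]_N (conv A).
Proof.
apply/convex_setP => x y t Ax Ay t01 C [/= cC AC].
by move/convex_setP: (cC); apply=> //; [apply: Ax|apply: Ay].
Qed.

Lemma conv_least A C : @convex_set R 'rV[R]_N C -> A `<=` C -> conv A `<=` C.
Proof. exact: smallest_sub. Qed.

Lemma sub_conv A : A `<=` conv A.
Proof. exact: sub_gen_smallest. Qed.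

(** Removing a vertex from a convex set leaves a convex set; if the vertex were
    not in [A], the hull of [A] would already fit into what is left. *)
Lemma vertex_conv A a : vertex (conv A) a -> A a.
Proof.
move=> [Aa ext]; apply: contrapT => nAa.
suff : conv A `<=` conv A `&` ~` [set a] by move=> /(_ a Aa)[_]; apply.
apply: (@conv_least A (conv A `&` ~` [set a])) => [|x Ax]; last first.
  by split; [exact: sub_conv|move=> xa; apply: nAa; rewrite -xa].
apply/convex_setP => x y t [Ax /= xa] [Ay /= ya] /andP[t0 t1]; split.
  by move/convex_setP: (@conv_convex A); apply=> //; rewrite t0.
move=> /= aE; move: t0; rewrite le_eqVlt => /predU1P[t0|t0].
  by apply: ya; rewrite -aE -t0 scale0r add0r subr0 scale1r.
move: t1; rewrite le_eqVlt => /predU1P[t1|t1].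
  by apply: xa; rewrite -aE t1 subrr scale0r addr0 scale1r.
by have [] := ext x y t Ax Ay _ (esym aE); rewrite ?t0.
Qed.

Lemma convex_average C n (v : 'I_n -> 'rV[R]_N) : (0 < n)%N ->
  @convex_set R 'rV[R]_N C -> (forall i, C (v i)) ->
  C (n%:R^-1 *: \sum_i v i).
Proof.
case: n v => // n v _ /convex_setP hC; elim: n v => [|n IH] v Cv.
  by rewrite big_ord1 invr1 scale1r.
rewrite big_ord_recr /=.
set s := \sum_(i < _) _.
have n2 : n.+2%:R != 0 :> R by rewrite pnatr_eq0.
have n1 : n.+1%:R != 0 :> R by rewrite pnatr_eq0.
have -> : n.+2%:R^-1 *: (s + v ord_max) =
    (n.+1%:R / n.+2%:R) *: (n.+1%:R^-1 *: s) + (1 - n.+1%:R / n.+2%:R) *: v ord_max.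
  rewrite scalerA scalerDr; congr (_ *: _ + _ *: _); first by rewrite mulrAC mulfV // mul1r.
  by rewrite -[X in X - _](mulfV n2) -mulrBl -natrB // subSnn mul1r.
apply: hC => //; first by apply: IH => i.
by rewrite divr_ge0 ?ler0n //= ler_pdivrMr ?ltr0n // mul1r ler_nat.
Qed.

Lemma interior_shift C a (i : 'I_N) : interior C a ->
  exists2 r : R, 0 < r & C (a + r *: delta_mx 0 i) /\ C (a - r *: delta_mx 0 i).
Proof.
rewrite /interior /= => /nbhs_ballP[r /= r0 rC]; exists (r / 2); first by rewrite divr_gt0.
have small s : `|s| = r / 2 -> ball a r (a + s *: delta_mx 0 i).
  move=> sr; split=> // k j; rewrite ord1 !mxE eqxx /= -ball_normE /= opprD addNKr normrN normrM sr.
  have : `|(j == i)%:R : R| <= 1 by case: (_ == _); rewrite ?normr1 ?normr0.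
  nra.
split; apply: rC; first by apply: small; rewrite ger0_norm // ltW // divr_gt0.
by rewrite -scaleNr; apply: small; rewrite normrN ger0_norm // ltW // divr_gt0.
Qed.

(** [C] contains the cross-polytope around [a]. A point within [1 / N] of [a] in
    every coordinate is the average of [N] points on its axes: the [i]-th one
    carries [N] times the [i]-th coordinate of the displacement. *)
Lemma cross_interior C a : @convex_set R 'rV[R]_N C -> (0 < N)%N ->
  (forall i, C (a + delta_mx 0 i)) -> (forall i, C (a - delta_mx 0 i)) ->
  interior C a.
Proof.
move=> cC N0 Cp Cm; rewrite /interior /=; apply/nbhs_ballP; exists N%:R^-1.
  by rewrite /= invr_gt0 ltr0n.
move=> y ay.
have ayi i : `|N%:R * (y 0 i - a 0 i)| <= 1.
  have := ay.2 0 i; rewrite -ball_normE /= => /ltW.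
  by rewrite normrM distrC ger0_norm ?ler0n // -ler_pdivlMl ?ltr0n // mulr1.
pose v i := a + (N%:R * (y 0 i - a 0 i)) *: delta_mx 0 i.
have Cv i : C (v i).
  have := ayi i; rewrite ler_norml => /andP[s1 s2].
  (* [v i] lies on the segment from [a - e_i] to [a + e_i]. *)
  have -> : v i = ((1 + N%:R * (y 0 i - a 0 i)) / 2) *: (a + delta_mx 0 i) +
     (1 - (1 + N%:R * (y 0 i - a 0 i)) / 2) *: (a - delta_mx 0 i).
    by apply/rowP => j; rewrite /v !mxE; field.
  by move/convex_setP: cC; apply=> //; apply/andP; split; lra.
suff -> : y = N%:R^-1 *: \sum_i v i by exact: convex_average.
have n1 : N%:R != 0 :> R by rewrite pnatr_eq0 -lt0n.
rewrite big_split /= sumr_const card_ord -[a *+ N]scaler_nat scalerDr scalerA mulVf // scale1r.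
apply/rowP => j; rewrite mxE [X in _ + X]mxE summxE (bigD1 j) //= big1 ?addr0.
  by rewrite !mxE !eqxx /= mulr1 mulrA mulVf // mul1r addrC subrK.
by move=> i ij; rewrite !mxE eqxx eq_sym (negPf ij) mulr0.
Qed.
End Convex.

(** * The polytope of feasible vectors *)

Section FeasiblePolytope.
Variables (R : realType) (N : nat) (p : pred 'I_N) (c : 'I_N -> nat).
Local Open Scope classical_set_scope.
Local Open Scope ring_scope.
Implicit Types (x : 'rV[R]_N) (a : multinom N).

Definition feasible_polytope : set 'rV[R]_N :=
  conv [set exponent_vector R a | a in [set a : multinom N | feasible p c a]].

Lemma feasible_polytopeX a : feasible p c a -> feasible_polytope (exponent_vector R a).
Proof. by move=> ?; apply: sub_conv; exists a. Qed.

(** This real polyhedron contains the hull and its lattice points are the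
    feasible vectors; through it the inequalities reach the lattice points of
    the hull and of its dilates. *)
Definition relaxed x :=
  [/\ forall i, 0 <= x 0 i, forall i, x 0 i <= (c i)%:R,
      \sum_(i | p i) x 0 i <= (capacity p c)%:R &
      \sum_(i | predC p i) x 0 i <= (capacity p c)%:R].

Lemma sum_exponent_vector (r : pred 'I_N) a :
  \sum_(i | r i) exponent_vector R a 0 i = (weight r a)%:R.
Proof. by rewrite natr_sum; apply: eq_bigr => i _; rewrite mxE. Qed.

Lemma relaxed_exponent_vector a : feasible p c a -> relaxed (exponent_vector R a).
Proof.
move=> [ac ap aq]; split=> [i|i||]; rewrite ?sum_exponent_vector ?mxE ?ler_nat //.
Qed.

Lemma feasible_polytope_relaxed : feasible_polytope `<=` relaxed.
Proof.
apply: conv_least => [|_ [a fa <-]]; last exact: relaxed_exponent_vector.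
apply/convex_setP => x y t [x0 xc xp xq] [y0 yc yp yq] /andP[t0 t1].
have comb_le (u v r : R) : u <= r -> v <= r -> t * u + (1 - t) * v <= r by nra.
have sumE (r : pred 'I_N) : \sum_(i | r i) (t *: x + (1 - t) *: y) 0 i =
    t * \sum_(i | r i) x 0 i + (1 - t) * \sum_(i | r i) y 0 i.
  by rewrite !mulr_sumr -big_split; apply: eq_bigr => i _; rewrite !mxE.
split=> [i|i||]; rewrite ?sumE ?mxE ?comb_le //.
by rewrite addr_ge0 ?mulr_ge0 // subr_ge0.
Qed.

Lemma lattice_point_mnm x : lattice_point x -> (forall i, 0 <= x 0 i) ->
  exists a, x = exponent_vector R a.
Proof.
move=> xint x0; have nat_x i : exists n, x 0 i = n%:R.
  by apply/natrP; rewrite natrEint xint x0.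
exists (mnm_of (fun i => projT1 (cid (nat_x i)))); apply/rowP => i.
by rewrite mxE mnm_ofE; exact: projT2 (cid (nat_x i)).
Qed.

Lemma exponent_vector_lattice a : lattice_point (exponent_vector R a).
Proof. by move=> i; rewrite mxE; exact: natr_int. Qed.

Lemma exponent_vectorD a (i : 'I_N) :
  exponent_vector R (mnm_add a (mnm1 i)) = exponent_vector R a + delta_mx 0 i.
Proof. by apply/rowP => j; rewrite !mxE mnmDE natrD mnm1E eq_sym. Qed.

Lemma feasible_polytope_lattice : lattice_polytope feasible_polytope.
Proof.
split; last first.
  by move=> x /vertex_conv[a _ <-]; exact: exponent_vector_lattice.
eexists; [|reflexivity]; apply/finite_image.
pose M := \max_i c i.
apply: (@sub_finite_set _ _
  [set mnm_of (fun i => g i) | g in [set: {ffun 'I_N -> 'I_M.+1}]]).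
  move=> a [ac _ _]; exists [ffun i => inord (a i)] => //.
  apply/mnmP => i; rewrite mnm_ofE ffunE inordK // ltnS (leq_trans (ac i)) //.
  exact: leq_bigmax.
exact: finite_image.
Qed.

Lemma feasible_polytope_full : (forall i, (0 < c i)%N) ->
  (0 < capacity p c)%N -> full_dimensional feasible_polytope.
Proof.
move=> c_gt0 cap_gt0; have f0 : feasible p c (mnm0 : multinom N).
  by split=> [i||]; rewrite ?mnm0E // [weight _ _]big1 // => i _; rewrite mnm0E.
have e0 : exponent_vector R (mnm0 : multinom N) = 0.
  by apply/rowP => j; rewrite !mxE mnm0E.
exists 0, 1%:M; split; last by rewrite mxrank1.
  by rewrite -e0; exact: feasible_polytopeX.
move=> i; rewrite -e0 row1 -exponent_vectorD add0m; apply: feasible_polytopeX.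
split=> [j||]; rewrite ?weight1; [|by case: (p i)|by case: (predC p i)].
by rewrite mnm1E; case: (i == j).
Qed.

(** A lattice point of the [k]-th dilate satisfies the [k]-fold constraints,
    and [deal2] splits it into [k] feasible vectors. *)
Lemma feasible_polytope_normal : (forall i, (0 < c i)%N) ->
  (0 < capacity p c)%N -> normal_polytope feasible_polytope.
Proof.
move=> c_gt0 cap_gt0; split; [exact: feasible_polytope_lattice|exact: feasible_polytope_full|].
move=> k _ k2 [y /feasible_polytope_relaxed[y0 yc yp yq] <-] xint.
have k0 : (0 < k)%N by exact: ltnW.
have kR : 0 < k%:R :> R by rewrite ltr0n.
have [i|a yE] := lattice_point_mnm xint; first by rewrite mxE mulr_ge0.
have scaled (r : pred 'I_N) m : \sum_(i | r i) y 0 i <= m%:R -> (weight r a <= k * m)%N.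
  move=> h; rewrite -(ler_nat R) -sum_exponent_vector -yE natrM.
  under eq_bigr do rewrite mxE.
  by rewrite -mulr_sumr ler_pM2l.
have [i|||b [bs bf]] := @deal2 _ k p a c (capacity p c) k0.
- by rewrite -(ler_nat R) natrM; move/rowP/(_ i): yE; rewrite !mxE => <-; rewrite ler_pM2l.
- exact: scaled.
- exact: scaled.
exists (fun l => exponent_vector R (mnm_of (b l))) => [l|].
  split; last exact: exponent_vector_lattice.
  apply: feasible_polytopeX; have [b1 b2 b3] := bf l.
  by split=> [i||]; rewrite ?weight_mnm_of // mnm_ofE.
rewrite yE; apply/rowP => i; rewrite mxE -bs natr_sum summxE.
by apply: eq_bigr => l _; rewrite mxE mnm_ofE.
Qed.

Definition strictly_feasible a := [/\ forall i, (0 < a i < c i)%N,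
  (weight p a < capacity p c)%N & (weight (predC p) a < capacity p c)%N].

(** An interior point can be pushed a little along each axis, which makes every
    constraint strict. Conversely, strict integer inequalities leave room for a
    whole unit step along each axis, and [cross_interior] applies. *)
Lemma interior_latticeP x : (exists i, p i) -> (exists i, ~~ p i) ->
  interior feasible_polytope x /\ lattice_point x <->
  exists2 a, strictly_feasible a & x = exponent_vector R a.
Proof.
move=> [i0 pi0] [j0 pj0]; split.
  move=> [xint xlat]; have [x0 _ _ _] := feasible_polytope_relaxed (interior_subset xint).
  have [a aE] := lattice_point_mnm xlat x0; exists a => //; rewrite {x xlat x0}aE in xint.
  have room i := interior_shift i xint.
  have sum_room (r : pred 'I_N) i s m : r i -> 0 < s ->
      \sum_(j | r j) (exponent_vector R a + s *: delta_mx 0 i) 0 j <= m%:R -> (weight r a < m)%N.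
    move=> ri s0; under eq_bigr do rewrite mxE.
    rewrite big_split /= sum_exponent_vector (bigD1 i) //= !mxE !eqxx mulr1 big1.
      by rewrite addr0 -(ltr_nat R) => h; apply: lt_le_trans h; rewrite ltrDl.
    by move=> j /andP[_ ji]; rewrite !mxE (negPf ji) andbF mulr0.
  split=> [i||].
  - have [s s0 [/feasible_polytope_relaxed[_ hi _ _] /feasible_polytope_relaxed[lo _ _ _]]] := room i.
    have := hi i; have := lo i; rewrite !mxE !eqxx mulr1 -!(ltr_nat R); lra.
  - have [s s0 [/feasible_polytope_relaxed[_ _ h _] _]] := room i0.
    exact: sum_room pi0 s0 h.
  - have [s s0 [/feasible_polytope_relaxed[_ _ _ h] _]] := room j0.
    exact: sum_room pj0 s0 h.
move=> [a [ac ap aq] ->]; split; last exact: exponent_vector_lattice.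
have N0 : (0 < N)%N by exact: leq_ltn_trans (ltn_ord i0).
apply: cross_interior => // [|i|i]; first exact: conv_convex.
  rewrite -exponent_vectorD; apply: feasible_polytopeX.
  split=> [j||]; rewrite ?weightD ?weight1.
  - rewrite mnmDE mnm1E; have /andP[_ h] := ac j.
    by case: (i == j); rewrite ?addn1 ?addn0 // ltnW.
  - by case: (p i); rewrite ?addn1 ?addn0 // ltnW.
  - by case: (predC p i); rewrite ?addn1 ?addn0 // ltnW.
have ia : lem (mnm1 i) a by rewrite lep1mP -lt0n; case/andP: (ac i).
have aE := submK ia; rewrite -[in X in _ (X - _)]aE exponent_vectorD addrK.
apply: feasible_polytopeX; rewrite -aE in ac ap aq.
move: ap aq; rewrite !weightD => /(leq_ltn_trans (leq_addr _ _))/ltnW ap /(leq_ltn_trans (leq_addr _ _))/ltnW aq.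
split=> // j; have := ac j; rewrite mnmDE => /andP[_].
by move=> /(leq_ltn_trans (leq_addr _ _))/ltnW.
Qed.
End FeasiblePolytope.

(** * Uniqueness of the inner vector *)

Section UniqueInterior.
Variable I : finType.
Implicit Types (p q : pred I) (c : I -> nat).

Definition bump1 (i j : I) := 1 + (j == i).

Lemma weight_bump1 p i : weight p (bump1 i) = #|p| + p i.
Proof.
rewrite /weight big_split /= sum1_card; congr (_ + _); have [pi|pi] := boolP (p i).
  by rewrite (bigD1 i) //= eqxx big1 // => j /andP[_ /negPf->].
by rewrite big1 // => j pj; case: eqVneq => // ji; rewrite -ji pj in pi.
Qed.

(** If an inner vector exists, the all-ones vector [1] is inner too. By
    uniqueness no [1 + e_i], i.e. no [bump1 i], is inner, so the bound [c i]
    cannot exceed 2 where the side sums leave room for one more unit. On the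
    lighter side [p] they always do; hence [c] is 2 there and the capacity is
    [2 #|p|], which must exceed [#|q|]. If [q] had fewer vertices than [p], some
    bound on [q] would exceed 2, since [q] is the heavier side, and there would
    be room again. *)
Lemma unique_interior_sizes p q c :
  (forall i, q i = ~~ p i) -> (exists i, p i) -> weight p c <= weight q c ->
  let inner a := [/\ forall i, 0 < a i < c i, weight p a < weight p c &
                     weight q a < weight p c] in
  (exists a, inner a) -> (forall a b, inner a -> inner b -> a =1 b) ->
  #|p| <= #|q| <= 2 * #|p| - 1.
Proof.
move=> qE p0 pq inner [a [ac ap aq]] uniq.
have c2 i : 1 < c i by have /andP[a0] := ac i; apply: leq_trans.
have one_le r : #|r| <= weight r a.
  rewrite -[#|r|]muln1 -weight_const; apply: weight_leP => i _.
  by case/andP: (ac i).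
have inner1 : inner (fun=> 1).
  by split=> [i||]; rewrite ?c2 // weight_const muln1 (leq_ltn_trans (one_le _)).
have no_bump i : ~ inner (bump1 i).
  by move=> /(uniq _ _ inner1)/(_ i); rewrite /bump1 eqxx.
have bump_range i : 2 < c i -> forall j, 0 < bump1 i j < c j.
  by move=> ci j; rewrite /bump1; case: eqVneq => [->|_] //=; rewrite addn0 c2.
have cp i : p i -> c i = 2.
  move=> pi; apply/eqP; rewrite eqn_leq c2 andbT leqNgt; apply/negP => ci.
  apply: (no_bump i); split; first exact: bump_range.
    by apply: weight_lt => // j _; case/andP: (bump_range i ci j).
  by rewrite weight_bump1 qE pi addn0 (leq_ltn_trans (one_le q)).
have pc : weight p c = #|p| * 2 by rewrite -weight_const; apply: eq_bigr.
have qp : #|q| < #|p| * 2 by rewrite -pc (leq_ltn_trans (one_le q)).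
have p_gt0 : 0 < #|p| by case: p0 => i pi; apply/card_gt0P; exists i.
suff : #|p| <= #|q| by lia.
rewrite leqNgt; apply/negP => qltp.
have /exists_inP[j qj cj] : [exists j in q, 2 < c j].
  apply: contraTT pq => /exists_inPn h; rewrite -ltnNge pc.
  have : weight q c <= #|q| * 2.
    by rewrite -weight_const; apply: weight_leP => i /h; rewrite -leqNgt.
  lia.
apply: (no_bump j); split; first exact: bump_range.
  by rewrite weight_bump1 pc; move: qj; rewrite unfold_in qE => /negPf->; lia.
by rewrite weight_bump1 pc; case: (q j); lia.
Qed.
End UniqueInterior.

(** * Labelings of complete bipartite graphs *)

Section Labeling.
Local Open Scope classical_set_scope.

Lemma card_eq_I1P (T : Type) (A : set T) :
  (A #= `I_1)%card <-> exists2 x, A x & forall y, A y -> y = x.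
Proof.
split=> [|[x Ax uniq]].
  move=> /eq_cardSP[x Ax]; rewrite II0 card_eq0 => /eqP D0; exists x => // y Ay.
  by apply: contrapT => yx; have : (A `\ x) y by []; rewrite D0.
suff -> : A = [set x] by exact: card_set1.
by apply/seteqP; split=> [y /uniq|_ ->].
Qed.

Lemma bipartition (N n m : nat) (e : rel 'I_N) :
  graph_iso e (@complete_bipartite_rel n m) ->
  exists p : pred 'I_N, [/\ forall i j, e i j = (p i != p j), #|p| = n & #|predC p| = m].
Proof.
move=> [f f_bij fe]; exists (fun i => if f i is inl _ then true else false).
split=> [i j||].
- by rewrite -fe; case: (f i) => ?; case: (f j).
- rewrite -sum1_card.
  transitivity (\sum_(z : 'I_n + 'I_m | if z is inl _ then true else false) 1).
    by rewrite (reindex f) //; exact: onW_bij.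
  by rewrite big_sumType /= [X in _ + X]big_pred0 // addn0 sum1_card card_ord.
rewrite -sum1_card.
transitivity (\sum_(z : 'I_n + 'I_m | if z is inl _ then false else true) 1).
  rewrite (reindex f) /=; last exact: onW_bij.
  by apply: eq_bigl => i; rewrite unfold_in /=; case: (f i).
by rewrite big_sumType /= [X in X + _]big_pred0 // add0n sum1_card card_ord.
Qed.

Lemma graph_iso_swap (V : finType) (e : rel V) n m :
  graph_iso e (@complete_bipartite_rel n m) -> graph_iso e (@complete_bipartite_rel m n).
Proof.
move=> [f f_bij fe].
pose s n m (z : 'I_n + 'I_m) : 'I_m + 'I_n := match z with inl i => inr i | inr j => inl j end.
exists (s n m \o f) => [|x y].
  by apply: bij_comp => //; exists (s m n); case.
by rewrite -fe /=; case: (f x); case: (f y).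
Qed.

(** Ideals and polytopes disappear here: what is left to study is the number of
    integer vectors satisfying strict inequalities. *)
Lemma labeling_bipartite (K : fieldType) (R : realType) (N : nat) (e : rel 'I_N)
    (p : pred 'I_N) :
  (forall i j, e i j = (p i != p j)) -> (exists i, p i) -> (exists i, ~~ p i) ->
  labeling_pseudo_Gorenstein_star K R e <->
  exists2 c : 'I_N -> nat, (forall i, 0 < c i) &
    exists2 a : multinom N, strictly_feasible p c a &
      forall b : multinom N, strictly_feasible p c b -> b = a.
Proof.
move=> e_bip p0 q0.
have cap0 c : (forall i, 0 < c i) -> 0 < capacity p c.
  move=> c0; rewrite /capacity leq_min; have pos (r : pred 'I_N) : (exists i, r i) -> 0 < weight r c.
    by move=> r0; apply: leq_ltn_trans (weight_lt (a := fun=> 0) r0 _) => // i _.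
  by rewrite !pos.
suff step c : (forall i, 0 < c i) ->
    pseudo_Gorenstein_star (conv [set exponent_vector R a | a in Dset K e c]) <->
    exists2 a : multinom N, strictly_feasible p c a &
      forall b : multinom N, strictly_feasible p c b -> b = a.
  by split=> -[c c0 /(step c c0) ?]; exists c.
move=> c0; rewrite (DsetE K e_bip (cap0 c c0)) -/(@feasible_polytope R N p c).
have intP (x : 'rV[R]_N) := interior_latticeP c x p0 q0.
have ev_inj : injective (@exponent_vector R N).
  move=> a b /rowP ab; apply/mnmP => i; have /eqP := ab i.
  by rewrite !mxE eqr_nat => /eqP.
split=> [[_ /card_eq_I1P[x]]|[a sa uniq]].
  move=> /intP[a sa ->] uniq; exists a => // b sb.
  by apply: ev_inj; apply: uniq; apply/intP; exists b.
split; first exact: feasible_polytope_normal (cap0 c c0).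
apply/card_eq_I1P; exists (exponent_vector R a) => [|y /intP[b /uniq -> ->] //].
by apply/intP; exists a.
Qed.
End Labeling.

Theorem theorem2p4 (K : fieldType) (R : realType) (N : nat) (e : rel 'I_N)
    (hN : 2 <= N) (he : simple_graph e) (hiso : no_isolated_vertex e)
    (hbip : complete_bipartite e) :
  labeling_pseudo_Gorenstein_star K R e <->
  exists n m : nat,
    [/\ 1 <= n, n <= m, m <= 2 * n - 1 &
        graph_iso e (@complete_bipartite_rel n m)].
Proof.
have side0 (r : pred 'I_N) k : 0 < k -> #|r| = k -> exists i, r i.
  by move=> k0 rk; apply/card_gt0P; rewrite rk.
split; last first.
  move=> [n [m [n1 nm mn iso]]]; have [p [e_bip pn qm]] := bipartition iso.
  have m1 := leq_trans n1 nm.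
  apply/(labeling_bipartite K R e_bip); [exact: side0 pn|exact: (side0 (predC p)) qm|].
  exists (fun=> 2) => //.
  have cap : capacity p (fun=> 2) = 2 * n.
    by rewrite /capacity !weight_const pn qm; lia.
  exists (mnm_of (fun=> 1)) => [|b [b2 _ _]].
    by split=> [i||]; rewrite ?mnm_ofE // weight_mnm_of weight_const cap ?pn ?qm; lia.
  by apply/mnmP => i; rewrite mnm_ofE; have := b2 i; lia.
have [n [m [n1 m1 iso]]] := hbip; have [p [e_bip pn qm]] := bipartition iso.
have p0 := side0 _ _ n1 pn; have q0 := side0 (predC p) _ m1 qm.
move=> /(labeling_bipartite K R e_bip p0 q0)[c c0 [a [ac ap aq] uniq]].
have uniq_fun (b1 b2 : 'I_N -> nat) :
    strictly_feasible p c (mnm_of b1) -> strictly_feasible p c (mnm_of b2) -> b1 =1 b2.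
  by move=> /uniq h1 /uniq h2 i; rewrite -[LHS]mnm_ofE -[RHS]mnm_ofE h1 h2.
have [pq|/ltnW qp] := leqP (weight p c) (weight (predC p) c).
  have capE : capacity p c = weight p c by apply/minn_idPl.
  exists n, m; rewrite capE in ap aq.
  have /andP[] : #|p| <= #|predC p| <= 2 * #|p| - 1.
    apply: (@unique_interior_sizes _ p (predC p) c) => //; first by exists a.
    move=> b1 b2 [b1c b1p b1q] [b2c b2p b2q].
    by apply: uniq_fun; split=> [i||]; rewrite ?mnm_ofE ?weight_mnm_of ?capE.
  by rewrite pn qm.
have capE : capacity p c = weight (predC p) c by apply/minn_idPr.
exists m, n; rewrite capE in ap aq.
have /andP[] : #|predC p| <= #|p| <= 2 * #|predC p| - 1.
  apply: (@unique_interior_sizes _ (predC p) p c) => //; last first.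
  - move=> b1 b2 [b1c b1p b1q] [b2c b2p b2q].
    by apply: uniq_fun; split=> [i||]; rewrite ?mnm_ofE ?weight_mnm_of ?capE.
  - by exists a.
  by move=> i /=; rewrite negbK.
by rewrite pn qm; split=> //; exact: graph_iso_swap.
Qed.
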